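(* For every parameter $\theta$, $$\nabla_\theta\,\mathbb{E}_{y\sim P_\theta}[\mathrm{Harm}(y)]=\sum_{t=1}^{T}\mathbb{E}_{y_{<t}}\Big[\mathrm{Cov}_{y_t\mid y_{<t}}\big(h_t(y_{\le t}),\ \nabla_\theta\log P_\theta(y_t\mid y_{<t})\big)\Big],$$ where the outer expectation is over $y_{<t}$ distributed according to $P_\theta$, and the covariance (a vector in $\mathbb{R}^d$, taken coordinatewise in the second argument) is with respect to $y_t\sim P_\theta(\cdot\mid y_{<t})$ with $y_{<t}$ fixed.
   Context: Let $\mathcal V$ be a finite vocabulary and $T\ge 1$ a fixed sequence length. For each $\theta\in\mathbb{R}^d$, $P_\theta$ is a probability distribution on sequences $y=(y_1,\dots,y_T)\in\mathcal V^T$ given by the autoregressive factorization $P_\theta(y)=\prod_{t=1}^T P_\theta(y_t\mid y_{<t})$, where $y_{<t}=(y_1,\dots,y_{t-1})$ (empty for $t=1$) and $y_{\le t}=(y_1,\dots,y_t)$. The conditional probabilities $P_\theta(y_t\mid y_{<t})$ are positive and differentiable in $\theta$, so that the score $\nabla_\theta\log P_\theta(y_t\mid y_{<t})$ exists. $\mathrm{Harm}:\mathcal V^T\to[0,1]$ is a fixed function not depending on $\theta$. The conditional expected harm is $h_t(y_{\le t}):=\mathbb{E}[\mathrm{Harm}(y)\mid y_1,\dots,y_t]$, where the expectation is over continuations $y_{>t}\sim P_\theta(\cdot\mid y_{\le t})$. *)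

(* Defs.v *)
From HB Require Import structures.
From mathcomp Require Import all_boot all_order all_algebra.
From mathcomp Require Import all_classical all_reals all_analysis.
Import Order.TTheory GRing.Theory Num.Theory.
Import numFieldNormedType.Exports.

Set Implicit Arguments.
Unset Strict Implicit.
Unset Printing Implicit Defensive.

Local Open Scope ring_scope.

(* Laws on a finite type are given by their mass functions [mu]. *)
Definition expect (R : realType) (X : finType) (mu f : X -> R) : R :=
  \sum_x mu x * f x.

Definition expect_row (R : realType) (X : finType) (d : nat) (mu : X -> R)
    (F : X -> 'rV[R]_d) : 'rV[R]_d :=
  \sum_x mu x *: F x.

Definition cov (R : realType) (X : finType) (mu f g : X -> R) : R :=
  expect mu (fun x => (f x - expect mu f) * (g x - expect mu g)).

Definition cov_row (R : realType) (X : finType) (d : nat) (mu f : X -> R)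
    (G : X -> 'rV[R]_d) : 'rV[R]_d :=
  \row_i cov mu f (fun x => G x 0 i).

(* E[f | A] for an event A of nonzero mass. *)
Definition cond_expect (R : realType) (X : finType) (mu : X -> R)
    (A : pred X) (f : X -> R) : R :=
  (\sum_(x | A x) mu x * f x) / (\sum_(x | A x) mu x).

Definition grad (R : realType) (d : nat) (f : 'rV[R]_d -> R) (theta : 'rV[R]_d)
    : 'rV[R]_d :=
  \row_i 'D_(delta_mx 0 i) f theta.

(* [q s v] is the probability of the token v after the prefix s; only the
   values at prefixes s with size s < T enter the law of a sequence. *)
Definition seq_law (R : realType) (V : finType) (T : nat) (q : seq V -> V -> R)
    (y : T.-tuple V) : R :=
  \prod_(t < T) q (take t y) (tnth y t).

Definition prefix_law (R : realType) (V : finType) (T : nat)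
    (q : seq V -> V -> R) (t : nat) (s : t.-tuple V) : R :=
  \sum_(y : T.-tuple V | take t y == s :> seq V) seq_law q y.

Arguments prefix_law {R V} T q t s.

(* h_t(s) with t = size s: the conditional expectation, under the joint law, of
   Harm given that the first t tokens are s. *)
Definition cond_harm (R : realType) (V : finType) (T : nat)
    (q : seq V -> V -> R) (Harm : T.-tuple V -> R) (s : seq V) : R :=
  cond_expect (@seq_law R V T q)
    (fun y : T.-tuple V => take (size s) y == s) Harm.

(* Main.v *)
(* By the log-derivative trick, the partial derivative of E[Harm] is the sum
   over t of E[Harm(y) score_t], with score_t the derivative of the
   log-probability of y_t given y_{<t}. Grouping the sequences by y_{<=t} replaces Harm(y) by
   h_t(y_{<=t}), and the resulting conditional expectation of the product
   h_t score_t is a covariance because the score has conditional mean 0. *)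

Require Import Defs.
From HB Require Import structures.
From mathcomp Require Import all_boot all_order all_algebra.
From mathcomp Require Import ring.
From mathcomp Require Import all_classical all_reals all_analysis.
Import Order.TTheory GRing.Theory Num.Theory.
Import numFieldNormedType.Exports.

Set Implicit Arguments.
Unset Strict Implicit.
Unset Printing Implicit Defensive.

Local Open Scope ring_scope.

Lemma derive_ln (R : realType) (W : normedModType R) (f : W -> R) (x e : W) :
  differentiable f x -> 0 < f x ->
  'D_e (fun y => ln (f y)) x = 'D_e f x / f x.
Proof.
move=> df fx0; have [dln ln'] := is_derive1_ln fx0.
have {}dln : differentiable (@ln R) (f x) by exact/derivable1_diffP.
rewrite (_ : (fun y => _) = @ln R \o f)// deriveE; last first.
  exact: differentiable_comp.
by rewrite diff_comp//= diff1E// derive1E ln' -deriveE.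
Qed.

Lemma differentiable_prod (R : realType) (W : normedModType R) (I : Type)
    (r : seq I) (f : I -> W -> R) (x : W) :
  (forall i, differentiable (f i) x) ->
  differentiable (fun y => \prod_(i <- r) f i y) x.
Proof.
move=> df; elim: r => [|i r IH].
  by under eq_fun do rewrite big_nil; exact: differentiable_cst.
by under eq_fun do rewrite big_cons; exact: differentiableM.
Qed.

(** Log-derivative trick: positivity allows each term of the product rule to be written with
    ['D_e (f i)] as [f i] times the derivative of its logarithm. *)
Lemma derive_prod (R : realType) (W : normedModType R) (I : Type)
    (r : seq I) (f : I -> W -> R) (x e : W) :
  (forall i, differentiable (f i) x) -> (forall i, 0 < f i x) ->
  'D_e (fun y => \prod_(i <- r) f i y) x =
  (\prod_(i <- r) f i x) * \sum_(i <- r) 'D_e (fun y => ln (f i y)) x.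
Proof.
move=> df f0; elim: r => [|i r IH].
  by under eq_fun do rewrite big_nil; rewrite derive_cst !big_nil mulr0.
under eq_fun do rewrite big_cons.
rewrite [LHS](@deriveM _ _ (f i) (fun y => \prod_(j <- r) f j y)); first last.
- exact/diff_derivable/differentiable_prod.
- exact: diff_derivable.
rewrite IH !big_cons derive_ln// /GRing.scale/=.
by field; rewrite gt_eqF.
Qed.

Lemma differentiable_sum_seq (R : realType) (W : normedModType R) (I : Type)
    (r : seq I) (f : I -> W -> R) (x : W) :
  (forall i, differentiable (f i) x) ->
  differentiable (fun y => \sum_(i <- r) f i y) x.
Proof.
move=> df; elim: r => [|i r IH].
  by under eq_fun do rewrite big_nil; exact: differentiable_cst.
by under eq_fun do rewrite big_cons; exact: differentiableD.
Qed.

Lemma derive_sum_seq (R : realType) (W : normedModType R) (I : Type)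
    (r : seq I) (f : I -> W -> R) (x e : W) :
  (forall i, differentiable (f i) x) ->
  'D_e (fun y => \sum_(i <- r) f i y) x = \sum_(i <- r) 'D_e (f i) x.
Proof.
move=> df; elim: r => [|i r IH].
  by under eq_fun do rewrite big_nil; rewrite derive_cst big_nil.
under eq_fun do rewrite big_cons.
rewrite [LHS](@deriveD _ _ _ (f i) (fun y => \sum_(j <- r) f j y)); first last.
- exact/diff_derivable/differentiable_sum_seq.
- exact: diff_derivable.
by rewrite IH big_cons.
Qed.

(* The probability of generating [w] after the prefix [r]. *)
Fixpoint chain (R : realType) (V : finType) (q : seq V -> V -> R)
    (r w : seq V) : R :=
  if w is v :: w' then q r v * chain q (rcons r v) w' else 1.

(** Bijection between nonempty tuples and head-tail pairs. [P] and [F] live on plain sequences, so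
    they can be reused as the tuple length changes during an induction. *)
Lemma sum_tupleS (R : realType) (V : finType) (n : nat) (P : pred (seq V))
    (F : seq V -> R) :
  \sum_(y : n.+1.-tuple V | P y) F y =
  \sum_(v : V) \sum_(w : n.-tuple V | P (v :: w)) F (v :: w).
Proof.
rewrite pair_big_dep/=.
rewrite (reindex (fun u : V * n.-tuple V => [tuple of u.1 :: u.2]))//=.
exists (fun y => (thead y, behead_tuple y)) => [[v w] _|y _] /=.
  by rewrite theadE; congr pair; apply: val_inj.
by rewrite [RHS]tuple_eta.
Qed.

Lemma seq_lawE (R : realType) (V : finType) (T : nat) (q : seq V -> V -> R)
    (y : T.-tuple V) : seq_law q y = chain q [::] y.
Proof.
rewrite /seq_law.
(* Generalizes over the tokens already generated: peeling off the head of [y] moves it to the end of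
   [r]. *)
suff H (r : seq V) :
    \prod_(t < T) q (r ++ take t y) (tnth y t) = chain q r y by exact: (H [::]).
elim: T r y => [|n IH] r y; first by rewrite big_ord0 tuple0.
case/tupleP: y => v w; rewrite big_ord_recl /= cats0 -IH; congr (_ * _).
by apply: eq_bigr => t _; rewrite tnthS cat_rcons.
Qed.

Lemma chain_rcons (R : realType) (V : finType) (q : seq V -> V -> R)
    (r s : seq V) (v : V) :
  chain q r (rcons s v) = chain q r s * q (r ++ s) v.
Proof.
elim: s r => [|u s IH] r /=; first by rewrite cats0 mulr1 mul1r.
by rewrite IH mulrA cat_rcons.
Qed.

Lemma chain_gt0 (R : realType) (V : finType) (T : nat) (q : seq V -> V -> R)
    (r s : seq V) :
  (forall s' v, (size s' < T)%N -> 0 < q s' v) ->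
  (size r + size s <= T)%N -> 0 < chain q r s.
Proof.
move=> q0; elim: s r => [|v s IH] r //= rs; rewrite mulr_gt0 ?IH//.
  by rewrite q0// (leq_trans _ rs)// addnS ltnS leq_addr.
by rewrite size_rcons addSnnS.
Qed.

(** The tokens after [s] sum out, since each conditional law has mass 1; the bound by [T] keeps
    every prefix met on the way in the range of that assumption. With [r] empty this computes the
    marginal law of a prefix. *)
Lemma sum_chain_prefix (R : realType) (V : finType) (T n : nat)
    (q : seq V -> V -> R) (r s : seq V) :
  (forall s', (size s' < T)%N -> \sum_v q s' v = 1) ->
  (size r + n <= T)%N -> (size s <= n)%N ->
  \sum_(y : n.-tuple V | take (size s) y == s) chain q r y = chain q r s.
Proof.
move=> q1; elim: n r s => [|n IH] r s rn sn.
  case: s sn => // _; rewrite (big_pred1 [tuple])// => y.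
  by rewrite tuple0 eqxx.
have IHr v s' : (size s' <= n)%N ->
    \sum_(y : n.-tuple V | take (size s') y == s') chain q (rcons r v) y =
    chain q (rcons r v) s'.
  by apply: IH; rewrite size_rcons addSnnS.
rewrite (@sum_tupleS _ _ _ (fun y => take (size s) y == s) (chain q r)).
case: s sn => [_|u s sn] /=.
  rewrite -[RHS](q1 r); last by rewrite (leq_trans _ rn)// addnS ltnS leq_addr.
  apply: eq_bigr => v _; rewrite -[RHS]mulr1 -mulr_sumr; congr (_ * _).
  rewrite -[RHS]/(chain q (rcons r v) [::]) -IHr//.
  by apply: eq_bigl => w; rewrite take0.
(* Only sequences whose head is [u] can have [u :: s] as a prefix. *)
rewrite (bigD1 u)//= [X in _ + X]big1 ?addr0; last first.
  by move=> v vu; rewrite big1// => w; rewrite eqseq_cons (negPf vu).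
rewrite -IHr// mulr_sumr; apply: eq_bigl => w.
by rewrite eqseq_cons eqxx.
Qed.

(** Partition of the sequences by the pair of [take t y] and [tnth y t], on whose classes [g] is
    constant. As [t] counts from 0, a class is fixed by the first [t.+1] tokens. *)
Lemma sum_by_prefix (R : realType) (V : finType) (T : nat) (t : 'I_T)
    (F : T.-tuple V -> R) (g : seq V -> V -> R) :
  \sum_(y : T.-tuple V) F y * g (take t y) (tnth y t) =
  \sum_(s : t.-tuple V) \sum_(v : V)
    (\sum_(y : T.-tuple V | take t.+1 y == rcons s v) F y) * g s v.
Proof.
have sz (y : T.-tuple V) : size (take t y) == t.
  by rewrite size_takel// size_tuple ltnW.
rewrite pair_big/=.
rewrite (partition_big (fun y => (Tuple (sz y), tnth y t)) xpredT)//=.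
apply: eq_bigr => -[s v] _ /=; rewrite mulr_suml.
have E (y : T.-tuple V) :
    (take t.+1 y == rcons s v) = ((Tuple (sz y), tnth y t) == (s, v)).
  rewrite (take_nth v) ?size_tuple// eqseq_rcons xpair_eqE -val_eqE /=.
  by rewrite (tnth_nth v).
apply: eq_big => y; first by rewrite E.
by move=> /eqP[<- <-].
Qed.

Lemma cov_centered (R : realType) (X : finType) (mu f g : X -> R) :
  expect mu g = 0 -> cov mu f g = expect mu (fun x => f x * g x).
Proof.
move=> g0; rewrite /cov g0 /expect.
under eq_bigr do rewrite subr0 mulrBl mulrBr [X in _ - X]mulrCA.
by rewrite sumrB -mulr_sumr -/(expect mu g) g0 mulr0 subr0.
Qed.

(** Each term [mu * D ln mu] equals [D mu], so the sum is the derivative of the total mass, which is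
    constantly 1. *)
Lemma expect_score (R : realType) (W : normedModType R) (X : finType)
    (mu : W -> X -> R) (x e : W) :
  (forall y, \sum_v mu y v = 1) -> (forall v, 0 < mu x v) ->
  (forall v, differentiable (fun y => mu y v) x) ->
  expect (mu x) (fun v => 'D_e (fun y => ln (mu y v)) x) = 0.
Proof.
move=> mu1 mu0 dmu; rewrite /expect.
under eq_bigr => v _ do
  rewrite (@derive_ln _ _ (fun y => mu y v))// mulrC divfK ?gt_eqF//.
rewrite -(@derive_sum_seq _ _ _ _ (fun v y => mu y v))//.
by under eq_fun do rewrite mu1; exact: derive_cst.
Qed.

Theorem theorem8 (R : realType) (V : finType) (T : nat) (hT : (1 <= T)%N)
  (d : nat) (p : 'rV[R]_d -> seq V -> V -> R)
  (p_gt0 : forall theta s v, (size s < T)%N -> 0 < p theta s v)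
  (p_sum1 : forall theta s, (size s < T)%N -> \sum_v p theta s v = 1)
  (p_diff : forall theta s v, (size s < T)%N ->
    differentiable (fun theta' => p theta' s v) theta)
  (Harm : T.-tuple V -> R) (Harm01 : forall y, 0 <= Harm y <= 1)
  (theta : 'rV[R]_d) :
  differentiable (fun theta' => expect (seq_law (p theta')) Harm) theta /\
  grad (fun theta' => expect (seq_law (p theta')) Harm) theta =
  \sum_(t < T)
    expect_row (prefix_law T (p theta) t) (fun s : t.-tuple V =>
      cov_row (p theta s)
        (fun v => cond_harm (p theta) Harm (rcons s v))
        (fun v => grad (fun theta' => ln (p theta' s v)) theta)).
Proof.
have sz (y : T.-tuple V) (t : 'I_T) : (size (take t y) < T)%N.
  by rewrite size_takel// size_tuple ltnW.
have dfactor (y : T.-tuple V) (t : 'I_T) :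
    differentiable (fun th => p th (take t y) (tnth y t)) theta.
  exact: p_diff.
have dlaw (y : T.-tuple V) : differentiable (fun th => seq_law (p th) y) theta.
  exact: (differentiable_prod _ (dfactor y)).
have dterm y : differentiable (fun th => seq_law (p th) y * Harm y) theta.
  by apply: differentiableM => //; exact: differentiable_cst.
split; first exact: differentiable_sum_seq.
apply/rowP => i; rewrite mxE summxE; set e := delta_mx 0 i.
pose score s v : R := 'D_e (fun th => ln (p th s v)) theta.
have dlawE (y : T.-tuple V) : 'D_e (fun th => seq_law (p th) y) theta =
    seq_law (p theta) y * \sum_(t < T) score (take t y) (tnth y t).
  exact: (derive_prod _ e (dfactor y) (fun t => p_gt0 _ _ _ (sz y t))).
have dtermE y : 'D_e (fun th => seq_law (p th) y * Harm y) theta =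
    \sum_(t < T) seq_law (p theta) y * Harm y * score (take t y) (tnth y t).
  (* [Harm y] does not depend on the parameter, so only the derivative of the law survives in the
     product rule. *)
  rewrite [LHS](@deriveM _ _ (fun th => seq_law (p th) y) (cst (Harm y))).
  - by rewrite derive_cst scaler0 add0r dlawE [_ *: _]mulrCA mulrA -mulr_sumr.
  - exact: diff_derivable.
  - exact: derivable_cst.
rewrite derive_sum_seq//.
under eq_bigr do rewrite dtermE.
(* After exchanging the sums, the identity is proved separately for each position [t]. *)
rewrite exchange_big/=; apply: eq_bigr => t _.
rewrite (sum_by_prefix t (fun y => seq_law (p theta) y * Harm y) score).
rewrite summxE; apply: eq_bigr => s _.
have szs : (size s < T)%N by rewrite size_tuple.
have -> : prefix_law T (p theta) t s = chain (p theta) [::] s.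
  rewrite /prefix_law; under eq_bigr do rewrite seq_lawE.
  rewrite -(sum_chain_prefix (r := [::]) (p_sum1 theta) (leqnn T) (ltnW szs)).
  by rewrite size_tuple.
(* The score has conditional mean 0 given [s], so the covariance becomes the expectation of a
   product. *)
rewrite !mxE cov_centered; last first.
  under eq_fun do rewrite mxE.
  by apply: (@expect_score _ _ _ (fun th => p th s)) => *;
    [exact: p_sum1 | exact: p_gt0 | exact: p_diff].
rewrite /expect mulr_sumr; apply: eq_bigr => v _.
rewrite mxE -/(score s v) /cond_harm /cond_expect size_rcons size_tuple.
rewrite 2!mulrA; congr (_ * _).
(* The denominator of [cond_harm] is the mass of the prefix [rcons s v], which is exactly the weight
   of [s] times that of [v]; being positive, it cancels against them. *)
have -> : \sum_(y : T.-tuple V | take t.+1 y == rcons s v) seq_law (p theta) y =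
    chain (p theta) [::] s * p theta s v.
  under eq_bigr do rewrite seq_lawE.
  rewrite -[RHS](chain_rcons _ [::])
    -(sum_chain_prefix (r := [::]) (p_sum1 theta) (leqnn T)) ?size_rcons//.
  by rewrite size_tuple.
rewrite mulrCA mulfV ?mulr1// mulf_neq0// gt_eqF//; last exact: p_gt0.
exact: (chain_gt0 (r := [::]) (p_gt0 theta) (ltnW szs)).
Qed.
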